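(* Let $m=3$. A simplex $s$ with vertices $x=0,z_1,z_2,z_3$ is guaranteed to be monotone causal if the speed profile $\mathcal{V}=\mathcal{V}(x)$ is convex, $\mathcal{V}_s\subset\Psi^1\cap\Psi^2\cap\Psi^3$, and $\mathcal{V}^r\subset\Pi^r$ for $r=1,2,3$.
   Context: Fix a point $x=0$ (coordinates centered at $x$) of an open $\Omega\subset\mathbb{R}^3$ and a Lipschitz continuous speed function with values $f(x,a)\in[F_1,F_2]$, $0<F_1\leq F_2<\infty$, for unit vectors $a\in S_2\subset\mathbb{R}^3$. The speed profile is $\mathcal{V}=\{f(x,a)a:a\in S_2\}$; it is called convex if the region it bounds, $\{\rho v: v\in\mathcal{V},\rho\in[0,1]\}$, is convex. The simplex $s$ has vertices $0,z_1,z_2,z_3$ with $z_1,z_2,z_3$ linearly independent. $\Xi_3=\{\xi\in\mathbb{R}^3:\xi_j\ge0,\sum_j\xi_j=1\}$. For $\xi\in\Xi_3$: $\tilde x_\xi=\sum_j\xi_jz_j$, $a_\xi=\tilde x_\xi/|\tilde x_\xi|$, and the cost is $C(\xi)=|\tilde x_\xi|/f(x,a_\xi)$. $v_j=f(x,z_j/|z_j|)\,z_j/|z_j|$ is the velocity toward $z_j$. $\mathcal{V}_s=\{v\in\mathcal{V}:v=\sum_{j=1}^3\theta_jv_j,\ \text{all }\theta_j\ge0\}$. For any permutation $(i,j,k)$ of $(1,2,3)$: $\Pi^k=\{\theta_1v_i+\theta_2v_j:\theta_1,\theta_2\in[0,1]\}$; $\mathcal{V}^k=\{\theta_1v_i+\theta_2v_j\in\mathcal{V}:\theta_1,\theta_2\ge0\}$;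 $\Psi^k=\{\theta_1v_k+\theta_2v: v\in\mathcal{V}^k,\ \theta_1\ge0,\ \theta_2\in[0,1]\}$. The simplex $s$ is monotone causal if for arbitrary vertex values $W_1,W_2,W_3\in\mathbb{R}$ there is a minimizer $\xi^*\in\Xi_3$ of $C(\xi)+\sum_j\xi_jW_j$ such that the minimum value is strictly greater than $W_j$ for every $j$ with $\xi^*_j>0$. (This is monotone causality of the corresponding mode of the stochastic shortest path problem obtained by semi-Lagrangian discretization, in which choosing $\xi$ costs $C(\xi)$ and leads to $z_j$ with probability $\xi_j$.) *)

(* Defs.v *)
From mathcomp Require Import all_boot all_order all_algebra.
From mathcomp Require Import all_classical all_reals all_analysis.

Set Implicit Arguments.
Unset Strict Implicit.
Unset Printing Implicit Defensive.

Import Order.TTheory GRing.Theory Num.Theory.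
Import numFieldNormedType.Exports.

Local Open Scope classical_set_scope.
Local Open Scope ring_scope.

Section Defs.
Context {R : realType}.
Implicit Types (g : 'rV[R]_3 -> R) (z : 'I_3 -> 'rV[R]_3).

(* The library norm `|x| on row vectors is the sup norm, hence this one. *)
Definition enorm (x : 'rV[R]_3) : R := Num.sqrt (\sum_i x 0 i ^+ 2).

Definition unit_sphere : set 'rV[R]_3 := [set a | enorm a = 1].

Definition direction (x : 'rV[R]_3) : 'rV[R]_3 := (enorm x)^-1 *: x.

(* Below, g is the directional speed f(x, .) at the fixed point x = 0, only
   ever evaluated on the unit sphere, and 0, z 0, z 1, z 2 are the vertices of
   the simplex. *)
Definition speed_profile g : set 'rV[R]_3 := [set g a *: a | a in unit_sphere].

Definition profile_region g : set 'rV[R]_3 :=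
  [set rho *: v | rho in `[0, 1] & v in speed_profile g].

Definition convex_profile g : Prop := convex_set (profile_region g).

Definition vertex_velocity g z (j : 'I_3) : 'rV[R]_3 :=
  g (direction (z j)) *: direction (z j).

Definition simplex_profile g z : set 'rV[R]_3 :=
  [set v | speed_profile g v /\
    exists2 theta : 'I_3 -> R, forall j, 0 <= theta j
      & v = \sum_j theta j *: vertex_velocity g z j].

(* For (i, j, k) a permutation of the indices, the sums over j != k in Pi^k and
   V^k have exactly the two terms in v_i and v_j; theta k is not used. *)
Definition Pi_face g z (k : 'I_3) : set 'rV[R]_3 :=
  [set v | exists2 theta : 'I_3 -> R, forall j, j != k -> 0 <= theta j <= 1
      & v = \sum_(j | j != k) theta j *: vertex_velocity g z j].

Definition face_profile g z (k : 'I_3) : set 'rV[R]_3 :=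
  [set v | speed_profile g v /\
    exists2 theta : 'I_3 -> R, forall j, j != k -> 0 <= theta j
      & v = \sum_(j | j != k) theta j *: vertex_velocity g z j].

Definition Psi g z (k : 'I_3) : set 'rV[R]_3 :=
  [set u | exists theta1 theta2 v,
    [/\ face_profile g z k v, 0 <= theta1, 0 <= theta2 <= 1
      & u = theta1 *: vertex_velocity g z k + theta2 *: v]].

Definition barycentric : set 'rV[R]_3 :=
  [set xi | (forall j, 0 <= xi 0 j) /\ \sum_j xi 0 j = 1].

Definition bary_point z (xi : 'rV[R]_3) : 'rV[R]_3 := \sum_j xi 0 j *: z j.

Definition cost g z (xi : 'rV[R]_3) : R :=
  enorm (bary_point z xi) / g (direction (bary_point z xi)).

Definition total_cost g z (W : 'I_3 -> R) (xi : 'rV[R]_3) : R :=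
  cost g z xi + \sum_j xi 0 j * W j.

Definition monotone_causal g z : Prop :=
  forall W : 'I_3 -> R, exists xi : 'rV[R]_3,
    [/\ barycentric xi,
        forall eta, barycentric eta ->
          total_cost g z W xi <= total_cost g z W eta
      & forall j, 0 < xi 0 j -> W j < total_cost g z W xi].

End Defs.

(* Main.v *)
Require Import Defs.
From mathcomp Require Import all_boot all_order all_algebra.
From mathcomp Require Import all_classical all_reals all_analysis.

Import Order.TTheory GRing.Theory Num.Theory.
Import numFieldNormedType.Exports.

Local Open Scope classical_set_scope.
Local Open Scope ring_scope.

(** Write [T x] for [travel_time g x], the time needed to go straight from the
    origin to [x]; it is positively homogeneous of degree 1, equals 1 on the
    speed profile, and the cost of [xi] is [T (\sum_j xi_j z_j)].

    The inclusion of the simplex part of the profile in [Psi^k] says that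
    deleting the [z_k]-component of a point of the cone spanned by the vertices
    never increases [T] ([travel_time_drop]): after scaling to [T x = 1], it
    writes [x] as a multiple of [v_k] plus [t v], with [v] on the profile,
    [v] in the face opposite to [z_k] and [t <= 1]. By linear independence [t v]
    is what remains of [x], and [T (t v) = t <= 1].

    The total cost is continuous on the compact set of barycentric coordinates,
    hence has minimizers ([total_cost_minimizer]). Choose one, [xi], with as few
    positive coordinates as possible, let [U] be the minimum, and suppose that
    [U <= W_k] although [xi_k > 0]. Deleting [xi_k] lowers
    [T (\sum_j xi_j z_j) + \sum_j xi_j W_j] by at least [xi_k W_k >= xi_k U],
    so it becomes at most [(1 - xi_k) U]. If [xi_k < 1], then
    dividing by [1 - xi_k] gives by homogeneity a minimizer of smaller support,
    which is absurd; if [xi_k = 1], then [U = T z_k + W_k > W_k], again absurd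
    ([drop_minimizer], [monotone_causal_of_drop]). *)

(** * Euclidean norm and directions *)

Section EuclideanNorm.
Context {R : realType}.
Implicit Types (x : 'rV[R]_3) (c : R).

Lemma enorm_ge0 x : 0 <= enorm x.
Proof. exact: sqrtr_ge0. Qed.

Lemma enormZ c x : 0 <= c -> enorm (c *: x) = c * enorm x.
Proof.
move=> c0; rewrite /enorm.
under eq_bigr do rewrite mxE exprMn.
by rewrite -mulr_sumr sqrtrM ?sqr_ge0// sqrtr_sqr ger0_norm.
Qed.

Lemma enorm_gt0 x : x != 0 -> 0 < enorm x.
Proof.
move=> /rV0Pn[i xi0]; rewrite sqrtr_gt0 (bigD1 i)//=.
by rewrite ltr_pwDl ?exprn_even_gt0// sumr_ge0// => j _; rewrite sqr_ge0.
Qed.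

Lemma enorm0 : enorm (0 : 'rV[R]_3) = 0.
Proof. by rewrite -(scale0r 0) enormZ// mul0r. Qed.

Lemma enorm_continuous : continuous (@enorm R).
Proof.
have sq i : continuous (fun x : 'rV[R]_3 => x 0 i ^+ 2).
  move=> x; apply: (@continuous_comp _ _ _ (fun y : 'rV[R]_3 => y 0 i)
    (fun r : R => r ^+ 2)); [exact: coord_continuous|exact: exprn_continuous].
move=> x; apply: continuous_comp; last exact: sqrt_continuous.
by apply: continuous_big => [|i _]; [exact: add_continuous|exact: sq].
Qed.

Lemma direction_unit x : x != 0 -> unit_sphere (direction x).
Proof.
move=> x0; have n0 := enorm_gt0 x x0.
by rewrite /unit_sphere/= enormZ ?invr_ge0 ?enorm_ge0// mulVf ?gt_eqF.
Qed.

Lemma directionZ c x : 0 < c -> direction (c *: x) = direction x.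
Proof.
move=> c0; rewrite /direction enormZ ?ltW// scalerA invfM mulrAC.
by rewrite mulVf ?gt_eqF// mul1r.
Qed.

Lemma direction_id x : enorm x = 1 -> direction x = x.
Proof. by move=> x1; rewrite /direction x1 invr1 scale1r. Qed.

Lemma direction_continuous x : x != 0 -> {for x, continuous (@direction R)}.
Proof.
move=> x0; apply: continuousZ; last exact: cvg_id.
by apply: (continuousV _ (enorm_continuous x)); rewrite gt_eqF ?enorm_gt0.
Qed.

End EuclideanNorm.

(** * Travel time *)

(** When the profile region is convex this is its Minkowski functional. *)
Definition travel_time {R : realType} (g : 'rV[R]_3 -> R) (x : 'rV[R]_3) : R :=
  enorm x / g (direction x).

Section TravelTime.
Context {R : realType} {g : 'rV[R]_3 -> R}.
Context (g_gt0 : forall a, unit_sphere a -> 0 < g a).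
Implicit Types (x : 'rV[R]_3) (c : R).

Lemma travel_timeZ c x : 0 <= c ->
  travel_time g (c *: x) = c * travel_time g x.
Proof.
rewrite le_eqVlt => /orP[/eqP<-|c0].
  by rewrite scale0r /travel_time enorm0 !mul0r.
by rewrite /travel_time enormZ ?ltW// directionZ// mulrA.
Qed.

Lemma travel_time_gt0 x : x != 0 -> 0 < travel_time g x.
Proof.
by move=> x0; rewrite divr_gt0 ?enorm_gt0// g_gt0//; exact: direction_unit.
Qed.

Lemma travel_time_profile x : speed_profile g x -> travel_time g x = 1.
Proof.
move=> [a a1 <-]; have ga := g_gt0 a a1.
rewrite travel_timeZ ?ltW// /travel_time direction_id// a1 mul1r.
by rewrite mulfV ?gt_eqF.
Qed.

Lemma velocity_travel_time x : x != 0 ->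
  g (direction x) *: direction x = (travel_time g x)^-1 *: x.
Proof. by move=> x0; rewrite /direction scalerA invf_div. Qed.

(** At the origin the direction jumps; the points with barycentric coordinates
    stay away from it because the vertices are linearly independent. *)
Lemma travel_time_continuous (k : R) x : x != 0 ->
  (forall a b, unit_sphere a -> unit_sphere b ->
     `|g a - g b| <= k * `|a - b|) ->
  {for x, continuous (travel_time g)}.
Proof.
move=> x0 g_lip; apply: continuousM; first exact: enorm_continuous.
apply: continuousV.
  by rewrite gt_eqF// g_gt0//; exact: direction_unit.
have y0 : \forall y \near x, y != 0.
  exact (@cvgr_neq0 _ _ _ (nbhs x) _ id x cvg_id x0).
(* k may be nonpositive, and e is divided by the Lipschitz constant *)
pose M := Num.max k 1.
have M0 : 0 < M by rewrite lt_max ltr01 orbT.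
have kM : k <= M by rewrite le_max lexx.
apply/(@cvgrPdist_lt _ _ _ (nbhs x)) => e e0.
have eM : 0 < e / M by rewrite divr_gt0.
have /(@cvgrPdist_lt _ _ _ (nbhs x))/(_ _ eM) := direction_continuous x x0.
apply: filterS2 y0 => y y0 xy.
apply: le_lt_trans (g_lip _ _ _ _) _; try exact: direction_unit.
apply: (@le_lt_trans _ _ (M * `|direction x - direction y|)).
  exact: ler_wpM2r.
by rewrite mulrC -ltr_pdivlMr.
Qed.

End TravelTime.

(** * Dropping a vertex *)

Definition drop_coord {R : realType} (k : 'I_3) (xi : 'rV[R]_3) : 'rV[R]_3 :=
  \row_j (if j == k then 0 else xi 0 j).

Section Simplex.
Context {R : realType} {g : 'rV[R]_3 -> R} {z : 'I_3 -> 'rV[R]_3}.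
Context (g_gt0 : forall a, unit_sphere a -> 0 < g a).
Context (z_free : free [tuple z j | j < 3]).
Implicit Types (xi : 'rV[R]_3).

Lemma vertex_comb_inj (a b : 'I_3 -> R) :
  \sum_j a j *: z j = \sum_j b j *: z j -> a =1 b.
Proof.
move=> ab j; have /freeP/(_ (fun i => a i - b i)) := z_free.
move=> /(_ _ j)/eqP; rewrite subr_eq0 => ab0; apply/eqP/ab0.
under eq_bigr => i _ do rewrite -tnth_nth tnth_mktuple scalerBl.
by rewrite sumrB ab subrr.
Qed.

Lemma bary_point_eq0 xi : bary_point z xi = 0 -> xi = 0.
Proof.
move=> x0; have h : \sum_j xi 0 j *: z j = \sum_(j < 3) 0 *: z j.
  by under [RHS]eq_bigr do rewrite scale0r; rewrite big1_eq.
by apply/rowP => j; rewrite mxE (vertex_comb_inj _ _ h).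
Qed.

Lemma vertex_neq0 j : z j != 0.
Proof.
apply/eqP => zj0.
have : delta_mx 0 j = 0 :> 'rV[R]_3.
  apply: bary_point_eq0; rewrite /bary_point big1// => i _; rewrite mxE eqxx/=.
  by case: eqP => [->|_]; rewrite ?zj0 ?scaler0 ?scale0r.
by move=> /rowP/(_ j)/eqP; rewrite !mxE !eqxx oner_eq0.
Qed.

Lemma bary_point_drop k xi :
  bary_point z (drop_coord k xi) = \sum_(j | j != k) xi 0 j *: z j.
Proof.
rewrite /bary_point (bigD1 k)//= mxE eqxx scale0r add0r.
by apply: eq_bigr => j /negbTE jk; rewrite mxE jk.
Qed.

Lemma bary_pointZ c xi : bary_point z (c *: xi) = c *: bary_point z xi.
Proof. by rewrite scaler_sumr; apply: eq_bigr => j _; rewrite mxE scalerA. Qed.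

(** The point is scaled onto the speed profile, where membership in [Psi^k]
    applies. Linear independence identifies the remainder after deleting the
    [z_k]-component with [t v], whose travel time is [t <= 1]. *)
Lemma travel_time_drop k xi : (forall j, 0 <= xi 0 j) ->
  simplex_profile g z `<=` Psi g z k ->
  travel_time g (bary_point z (drop_coord k xi))
    <= travel_time g (bary_point z xi).
Proof.
move=> xi_ge0 sub.
have [->|xi0] := eqVneq xi 0.
  by rewrite (_ : drop_coord k 0 = 0)//; apply/rowP => j; rewrite !mxE if_same.
set x := bary_point z xi.
have x0 : x != 0 by apply: contra_neq xi0; exact: bary_point_eq0.
have Tx := travel_time_gt0 g_gt0 x x0.
have Tz j := travel_time_gt0 g_gt0 _ (vertex_neq0 j).
have vE j : vertex_velocity g z j = (travel_time g (z j))^-1 *: z j.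
  by rewrite -velocity_travel_time // vertex_neq0.
have [|s [t [v [[Vv [th _ vth]] _ /andP[t0 t1] xE]]]] :=
    sub ((travel_time g x)^-1 *: x).
  split; first by rewrite -velocity_travel_time//; exists (direction x) => //;
    exact: direction_unit.
  (* the factor T (z j) compensates for v_j = z_j / T (z_j) *)
  exists (fun j => (travel_time g x)^-1 * xi 0 j * travel_time g (z j)).
    move=> j; apply: mulr_ge0 (ltW (Tz j)).
    by apply: mulr_ge0 (xi_ge0 j); rewrite invr_ge0 ltW.
  rewrite scaler_sumr; apply: eq_bigr => j _.
  by rewrite vE !scalerA mulfK ?gt_eqF.
(* the Psi^k decomposition of x / T x, in coordinates over the z j *)
have {}xE : \sum_j xi 0 j *: z j = \sum_j (travel_time g x *
    (if j == k then s else t * th j) / travel_time g (z j)) *: z j.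
  rewrite -/(bary_point z xi) -/x.
  rewrite -[LHS](@scalerKV _ _ (travel_time g x)) ?gt_eqF//.
  rewrite xE vth [RHS](bigD1 k)//= eqxx scalerDr vE !scalerA; congr (_ + _).
  rewrite scaler_sumr; apply: eq_bigr => j /negbTE jk.
  by rewrite jk vE !scalerA !mulrA.
have -> : bary_point z (drop_coord k xi) = (travel_time g x * t) *: v.
  rewrite bary_point_drop vth scaler_sumr; apply: eq_bigr => j /negbTE jk.
  by rewrite (vertex_comb_inj _ _ xE) jk vE !scalerA !mulrA.
rewrite travel_timeZ; last exact: mulr_ge0 (ltW Tx) t0.
by rewrite (travel_time_profile g_gt0 v)// mulr1 ler_piMr// ltW.
Qed.

End Simplex.

(** * Existence of minimizers *)

Section Existence.
Context {R : realType} {g : 'rV[R]_3 -> R} {z : 'I_3 -> 'rV[R]_3}.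
Context (g_gt0 : forall a, unit_sphere a -> 0 < g a).
Context (z_free : free [tuple z j | j < 3]).
Implicit Types (xi : 'rV[R]_3) (W : 'I_3 -> R).

Lemma barycentric_neq0 xi : barycentric xi -> xi != 0.
Proof.
move=> [_ xi1]; apply: contra_eq_neq xi1 => ->.
by rewrite big1 1?eq_sym ?oner_neq0// => j _; rewrite mxE.
Qed.

Lemma barycentric_vertex (k : 'I_3) : barycentric (delta_mx 0 k : 'rV[R]_3).
Proof.
split=> [j|]; first by rewrite mxE ler0n.
rewrite (bigD1 k)//= mxE !eqxx big1 ?addr0// => j /negbTE jk.
by rewrite mxE jk andbF.
Qed.

Lemma barycentric_compact : compact (@barycentric R).
Proof.
pose total (xi : 'rV[R]_3) := \sum_j xi 0 j.
have total_cont : continuous total.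
  apply: continuous_big => [|i _]; first exact: add_continuous.
  exact: coord_continuous.
rewrite (_ : barycentric =
  [set xi : 'rV[R]_3 | forall i, `[0, 1]%classic (xi ord0 i)] `&`
    total @^-1` [set 1]); last first.
  apply/seteqP; split=> xi [xi0 xi1]; split=> // j; last first.
    by have /= := xi0 j; rewrite in_itv/= => /andP[].
  rewrite /= in_itv/= xi0/= -xi1 (bigD1 j)//= lerDl.
  by rewrite sumr_ge0.
apply: compact_closedI.
  apply: (@rV_compact R 3 (fun=> `[0, 1]%classic)) => i.
  exact: segment_compact.
by apply: preimage_closed => // xi _; exact: total_cont.
Qed.

Lemma bary_point_continuous : continuous (bary_point z).
Proof.
apply: continuous_big => [|j _]; first exact: add_continuous.
by move=> xi; apply: continuousZr_tmp; exact: coord_continuous.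
Qed.

Lemma total_cost_minimizer (k : R) W :
  (forall a b, unit_sphere a -> unit_sphere b ->
     `|g a - g b| <= k * `|a - b|) ->
  exists2 xi, barycentric xi &
    forall eta, barycentric eta -> total_cost g z W xi <= total_cost g z W eta.
Proof.
move=> g_lip.
have W_cont : continuous (fun eta : 'rV[R]_3 => \sum_j eta 0 j * W j).
  apply: continuous_big => [|j _ eta]; first exact: add_continuous.
  by apply: continuousM; [exact: coord_continuous|exact: cst_continuous].
have [||xi /set_mem xiB xi_min] :=
    @compact_EVT_min _ _ (total_cost g z W) _ _ barycentric_compact.
- by exists (delta_mx 0 0); exact: barycentric_vertex.
- apply: continuous_in_subspaceT => xi /set_mem /barycentric_neq0 xi0.
  apply: continuousD.
    apply: (@continuous_comp _ _ _ (bary_point z) (travel_time g)).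
      exact: bary_point_continuous.
    apply: (travel_time_continuous g_gt0 _ _ _ g_lip).
    by apply: contra_neq xi0; exact: bary_point_eq0.
  exact: W_cont.
by exists xi => // eta etaB; apply: xi_min; exact: mem_set.
Qed.

End Existence.

(** * Minimizers of smallest support *)

Section Causality.
Context {R : realType} {g : 'rV[R]_3 -> R} {z : 'I_3 -> 'rV[R]_3}.
Context (g_gt0 : forall a, unit_sphere a -> 0 < g a).
Context (z_free : free [tuple z j | j < 3]).
Implicit Types (xi : 'rV[R]_3) (W : 'I_3 -> R).

Definition bary_support xi : {set 'I_3} := [set j | 0 < xi 0 j].

Lemma total_costZ W c xi : 0 <= c ->
  total_cost g z W (c *: xi) = c * total_cost g z W xi.
Proof.
move=> c0; rewrite /total_cost /cost bary_pointZ.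
rewrite -/(travel_time g _) travel_timeZ// mulrDr mulr_sumr; congr (_ + _).
by apply: eq_bigr => j _; rewrite mxE mulrA.
Qed.

Lemma bary_support_drop k xi c : 0 < c -> 0 < xi 0 k ->
  (#|bary_support (c *: drop_coord k xi)| < #|bary_support xi|)%N.
Proof.
move=> c0 xik; apply: proper_card; apply/properP; split.
  apply/fintype.subsetP => j; rewrite !inE !mxE pmulr_rgt0//.
  by case: eqP => // ->; rewrite ltxx.
by exists k; rewrite !inE ?mxE ?eqxx ?mulr0 ?ltxx.
Qed.

(** Vertex [k] contributes [xi_k W_k], at least its share [xi_k * total_cost xi]
    of the total cost, so the remaining vertices cost at most their share; by
    homogeneity that share renormalizes to the cost of [xi]. *)
Lemma drop_minimizer W k xi :
  travel_time g (bary_point z (drop_coord k xi))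
    <= travel_time g (bary_point z xi) ->
  barycentric xi -> 0 < xi 0 k -> total_cost g z W xi <= W k ->
  exists2 eta, barycentric eta /\ total_cost g z W eta <= total_cost g z W xi
    & (#|bary_support eta| < #|bary_support xi|)%N.
Proof.
move=> T_drop [xi0 xi1] xik min_le.
pose eta := drop_coord k xi; pose s := \sum_j eta 0 j.
have eta0 j : 0 <= eta 0 j by rewrite mxE; case: eqP.
have sE : s = 1 - xi 0 k.
  rewrite -xi1 /s (bigD1 k)//= [in RHS](bigD1 k)//= mxE eqxx add0r addrAC subrr.
  by rewrite add0r; apply: eq_bigr => j /negbTE jk; rewrite mxE jk.
have L_eta : total_cost g z W eta <= s * total_cost g z W xi.
  rewrite sE mulrBl mul1r lerBrDr.
  apply: (@le_trans _ _ (total_cost g z W eta + xi 0 k * W k)).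
    by rewrite lerD2l ler_wpM2l.
  rewrite /total_cost -addrA lerD//.
  rewrite (bigD1 k)//= [leRHS](bigD1 k)//= mxE eqxx mul0r add0r addrC lerD2l.
  by apply: ler_sum => j /negbTE jk; rewrite mxE jk.
have s_ge0 : 0 <= s by exact: sumr_ge0.
have [s0|s_neq0] := eqVneq s 0.
  (* here bary_point z xi = z k, and reaching it takes a positive time *)
  exfalso; move: min_le; apply/negP; rewrite -ltNge.
  have eta_eq0 j : eta 0 j = 0.
    by apply/eqP; have /eqP := s0; rewrite psumr_eq0// => /allP/(_ j);
      apply; rewrite mem_index_enum.
  have xik1 : xi 0 k = 1 by apply/eqP; rewrite eq_sym -subr_eq0 -sE s0.
  have -> : total_cost g z W xi = travel_time g (bary_point z xi) + W k.
    rewrite /total_cost; congr (_ + _).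
    rewrite (bigD1 k)//= xik1 mul1r big1 ?addr0//.
    move=> j /negbTE jk; have := eta_eq0 j.
    by rewrite mxE jk => ->; rewrite mul0r.
  rewrite ltrDr travel_time_gt0//.
  apply: contraTneq xik => /(bary_point_eq0 z_free)->.
  by rewrite mxE ltxx.
have s_gt0 : 0 < s by rewrite lt_neqAle eq_sym s_neq0.
exists (s^-1 *: eta); last by apply: bary_support_drop; rewrite ?invr_gt0.
split; last first.
  by rewrite total_costZ ?invr_ge0// ler_pdivrMl.
split=> [j|]; first by rewrite mxE mulr_ge0 ?invr_ge0.
by under eq_bigr do rewrite mxE; rewrite -mulr_sumr mulVf.
Qed.

(** Minimizers need not all satisfy the strict inequalities; those with the
    fewest positive coordinates do, since any violation yields a minimizer
    with fewer. The descent is an induction on the size of the support. *)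
Lemma monotone_causal_of_drop :
  (forall k xi, (forall j, 0 <= xi 0 j) ->
    travel_time g (bary_point z (drop_coord k xi))
      <= travel_time g (bary_point z xi)) ->
  (forall W, exists2 xi, barycentric xi & forall eta, barycentric eta ->
     total_cost g z W xi <= total_cost g z W eta) ->
  monotone_causal g z.
Proof.
move=> T_drop min_ex W; have [xi] := min_ex W.
have [n] := ubnP #|bary_support xi|; elim: n xi => // n IH xi xi_n xiB xi_min.
have [strict|] := pselect (forall j, 0 < xi 0 j -> W j < total_cost g z W xi).
  by exists xi.
move=> /existsNP[k /not_implyP[xik /negP]]; rewrite -leNgt => min_le.
have [xi0 _] := xiB.
have [eta [etaB eta_le] eta_xi] :=
  drop_minimizer W _ _ (T_drop k xi xi0) xiB xik min_le.
apply: (IH eta) => //; first exact: leq_trans eta_xi _.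
by move=> zeta /xi_min; exact: le_trans.
Qed.

End Causality.

(** * Monotone causality *)

Theorem theorem16 (R : realType) (Omega : set 'rV[R]_3)
    (f : 'rV[R]_3 -> 'rV[R]_3 -> R) (F1 F2 : R) (z : 'I_3 -> 'rV[R]_3)
    (Omega_open : open Omega) (Omega0 : Omega 0)
    (F1_gt0 : 0 < F1) (F1_le_F2 : F1 <= F2)
    (f_bounds : forall x a, Omega x -> unit_sphere a -> F1 <= f x a <= F2)
    (f_lipschitz : [lipschitz f p.1 p.2 | p in Omega `*` unit_sphere])
    (z_free : free [tuple z j | j < 3])
    (V_convex : convex_profile (f 0))
    (Vs_sub : simplex_profile (f 0) z `<=`
       \bigcap_(k in [set: 'I_3]) Psi (f 0) z k)
    (Vr_sub : forall r : 'I_3, face_profile (f 0) z r `<=` Pi_face (f 0) z r) :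
  monotone_causal (f 0) z.
Proof.
have f_gt0 a : unit_sphere a -> 0 < f 0 a.
  by move=> a1; have /andP[+ _] := f_bounds _ _ Omega0 a1; exact: lt_le_trans.
apply: (monotone_causal_of_drop f_gt0 z_free) => [k xi xi0|W].
  apply: (travel_time_drop f_gt0 z_free) => //.
  by move=> v /Vs_sub; exact.
have [K [_ K_lip]] := f_lipschitz.
apply: (total_cost_minimizer f_gt0 z_free (K + 1)) => a b a1 b1.
have KK : K < K + 1 by rewrite ltrDl.
have normE : `|(0, a) - (0, b) : 'rV[R]_3 * 'rV[R]_3| = `|a - b|.
  change (Num.max `|0 - 0 : 'rV[R]_3| `|a - b| = `|a - b|).
  by rewrite subrr normr0 max_r.
by rewrite -normE; apply: (K_lip _ KK ((0, a), (0, b))).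
Qed.
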